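(* Let $G$ be a bipartite graph. If $\gamma(G)=\beta(G)$, then $$\gamma_{\rm sp}(G)=\alpha(G).$$
   Context: All graphs are finite, simple and undirected. For a vertex $v$ of a graph $G$, $N(v)$ denotes the set of vertices adjacent to $v$. For $D\subseteq V(G)$ write $\overline{D}=V(G)\setminus D$. A set $D$ is dominating if every vertex in $\overline{D}$ has a neighbour in $D$; the domination number $\gamma(G)$ is the minimum cardinality of a dominating set. A set $D\subseteq V(G)$ is a super dominating set of $G$ if for every $u\in\overline{D}$ there exists $v\in D$ such that $N(v)\cap\overline{D}=\{u\}$; the super domination number $\gamma_{\rm sp}(G)$ is the minimum cardinality of a super dominating set of $G$. The vertex cover number $\beta(G)$ is the minimum cardinality of a set of vertices meeting every edge, and the independence number $\alpha(G)$ is the maximum cardinality of a set of pairwise non-adjacent vertices.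
   Formalization: The graph is assumed to have no isolated vertex; without this the claim fails, e.g. for the disjoint union of K_{3,3} and one isolated vertex, where γ = β = 3 but γ_sp = 5 and α = 4. *)

(* Defs.v *)
From mathcomp Require Import all_boot.

Set Implicit Arguments.
Unset Strict Implicit.
Unset Printing Implicit Defensive.

(* A finite simple graph is a symmetric irreflexive relation on a finType;
   the definitions below only use the adjacency relation. *)

Definition nbhd (T : finType) (e : rel T) (v : T) : {set T} := [set w | e v w].

Definition dominating (T : finType) (e : rel T) (D : {set T}) : bool :=
  [forall u in ~: D, [exists v in D, v \in nbhd e u]].

Definition super_dominating (T : finType) (e : rel T) (D : {set T}) : bool :=
  [forall u in ~: D, [exists v in D, nbhd e v :&: ~: D == [set u]]].

Definition vertex_cover (T : finType) (e : rel T) (C : {set T}) : bool :=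
  [forall x, forall y, e x y ==> (x \in C) || (y \in C)].

Definition independent (T : finType) (e : rel T) (A : {set T}) : bool :=
  [forall x in A, forall y in A, ~~ e x y].

Definition bipartite (T : finType) (e : rel T) : Prop :=
  exists A : {set T}, forall x y : T, e x y -> (x \in A) != (y \in A).

(* For the disjoint union of K_{3,3} and one isolated vertex, the domination and
   vertex cover numbers are both 3, while the super domination number is 5 and
   the independence number is 4; excluding isolated vertices rules this out. *)
Definition no_isolated_vertex (T : finType) (e : rel T) : Prop :=
  forall v : T, nbhd e v != set0.

(* [arg min] is a true minimiser only if its default value [set: T] satisfies
   the predicate; see dominatingT, super_dominatingT and vertex_coverT. *)
Definition domination_number (T : finType) (e : rel T) : nat :=
  #|[arg min_(D < [set: T] | dominating e D) #|D|]|.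

Definition super_domination_number (T : finType) (e : rel T) : nat :=
  #|[arg min_(D < [set: T] | super_dominating e D) #|D|]|.

Definition vertex_cover_number (T : finType) (e : rel T) : nat :=
  #|[arg min_(C < [set: T] | vertex_cover e C) #|C|]|.

Definition independence_number (T : finType) (e : rel T) : nat :=
  \max_(A : {set T} | independent e A) #|A|.

Lemma dominatingT (T : finType) (e : rel T) : dominating e [set: T].
Proof. by apply/forall_inP => u; rewrite setCT inE. Qed.

Lemma super_dominatingT (T : finType) (e : rel T) :
  super_dominating e [set: T].
Proof. by apply/forall_inP => u; rewrite setCT inE. Qed.

Lemma vertex_coverT (T : finType) (e : rel T) : vertex_cover e [set: T].
Proof. by apply/forallP => x; apply/forallP => y; rewrite inE implybT. Qed.

(* Main.v *)
(** For an independent set [A] and a super dominating set [D], sending a vertex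
    of [A :\: D] to the vertex of [D] that has it as its only neighbour outside
    [D] injects [A :\: D] into [D :\: A]; hence alpha <= gamma_sp.  Conversely
    (Bollobas and Cockayne), a graph without isolated vertices has a minimum
    dominating set [D] each of whose vertices has a private neighbour outside
    [D].  This says that the complement of [D] is super dominating, so
    gamma_sp <= n - gamma = n - beta <= alpha. *)
Require Import Defs.
From mathcomp Require Import all_boot.

Lemma domination_number_min (T : finType) (e : rel T) (D : {set T}) :
  dominating e D -> domination_number e <= #|D|.
Proof.
rewrite /domination_number; case: arg_minnP; first exact: dominatingT.
by move=> D0 _; apply.
Qed.

Lemma super_domination_number_min (T : finType) (e : rel T) (D : {set T}) :
  super_dominating e D -> super_domination_number e <= #|D|.
Proof.
rewrite /super_domination_number; case: arg_minnP.
  exact: super_dominatingT.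
by move=> D0 _; apply.
Qed.

Lemma independent_leq_super_dominating (T : finType) (e : rel T)
    (A D : {set T}) :
  independent e A -> super_dominating e D -> #|A| <= #|D|.
Proof.
move=> /forall_inP indA /forall_inP supD.
(* The default [u] is never reached for [u] outside [D], because [D] is super dominating. *)
pose f u := odflt u [pick v in D | nbhd e v :&: ~: D == [set u]].
have fP u : u \notin D -> f u \in D /\ nbhd e (f u) :&: ~: D = [set u].
  move=> uD; rewrite /f; case: pickP => [v /andP[vD /eqP Nv] //|no].
  have /supD/exists_inP[v vD Nv] : u \in ~: D by rewrite inE.
  by move: (no v); rewrite vD Nv.
have f_inj : {in A :\: D &, injective f}.
  move=> u u' /setDP[_ /fP[_ Nu]] /setDP[_ /fP[_ Nu']] eq_f.
  by apply: set1_inj; rewrite -Nu -Nu' eq_f.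
rewrite -(cardsID D A) -(cardsID A D) setIC leq_add2l -(card_in_imset f_inj).
apply/subset_leq_card/subsetP => _ /imsetP[u /setDP[uA uD] ->].
(* If [f u] were in [A], it would be adjacent to [u], also in [A], against independence. *)
have [fuD Nu] := fP u uD; rewrite inE fuD andbT; apply/negP => fuA.
have /setIP[] : u \in nbhd e (f u) :&: ~: D by rewrite Nu set11.
by rewrite inE => e_fu _; have /forall_inP/(_ u uA)/negP := indA _ fuA.
Qed.

Lemma vertex_coverC_independent (T : finType) (e : rel T) (C : {set T}) :
  vertex_cover e C -> independent e (~: C).
Proof.
move=> /forallP covC; apply/forall_inP => x; rewrite inE => xC.
apply/forall_inP => y; rewrite inE => yC; apply/negP => exy.
by have /forallP/(_ y) := covC x; rewrite exy (negPf xC) (negPf yC).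
Qed.

(** The complement of a minimum vertex cover is independent. *)
Lemma leq_card_vertex_cover_independence (T : finType) (e : rel T) :
  #|T| <= vertex_cover_number e + independence_number e.
Proof.
rewrite /vertex_cover_number; case: arg_minnP; first exact: vertex_coverT.
move=> C /vertex_coverC_independent indC _; rewrite -(cardsC C) leq_add2l.
exact: (leq_bigmax_cond (F := fun A : {set T} => #|A|)).
Qed.

(** An exchange argument: an [x] in [D] without a private neighbour could be swapped for a neighbour
    outside [D], leaving fewer induced isolated vertices. *)
Lemma exists_minimum_dominating_private (T : finType) (e : rel T) :
    symmetric e -> irreflexive e -> no_isolated_vertex e ->
  exists D : {set T}, #|D| = domination_number e /\
    forall x, x \in D -> exists2 v, v \notin D & nbhd e v :&: D = [set x].
Proof.
move=> e_sym e_irr e_noiso.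
pose isol (D : {set T}) := [set x in D | [forall w in D, ~~ e x w]].
pose minimum_dominating D := dominating e D && (#|D| == domination_number e).
pose D0 := [arg min_(D < [set: T] | dominating e D) #|D|].
have D0P : minimum_dominating D0.
  rewrite /minimum_dominating eqxx andbT /D0.
  by case: arg_minnP => //; exact: dominatingT.
(* Among the minimum dominating sets, [D] has the fewest vertices isolated in
   the subgraph that it induces. *)
have [D /andP[/forall_inP domD /eqP cardD] minD] :=
  arg_minnP (fun D => #|isol D|) D0P.
exists D; split=> // x xD.
have [/exists_inP[v vD /eqP Nv]|/exists_inPn noprv] :=
  boolP [exists v in ~: D, nbhd e v :&: D == [set x]].
  by exists v => //; rewrite inE in vD.
(* As [x] is the only [D]-neighbour of no outside vertex, all of these stay dominated once [x] is
   removed. *)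
have other v : v \notin D -> exists2 y, y \in D :\ x & e v y.
  move=> vD; have vDC : v \in ~: D by rewrite inE.
  apply/exists_inP; apply: contraR (noprv v vDC) => /exists_inPn noy.
  have sNx : nbhd e v :&: D \subset [set x].
    apply/subsetP => y /setIP[]; rewrite !inE => evy yD.
    by apply: contraLR evy => yx; apply: noy; rewrite !inE yx.
  have /exists_inP[y yD yv] := domD v vDC.
  have yI : y \in nbhd e v :&: D by rewrite inE yv.
  rewrite eqEsubset sNx sub1set.
  by have /set1P <- := subsetP sNx y yI.
(* A neighbour of [x] in [D] would make the smaller set [D :\ x] dominating. *)
have isoxD z : z \in D -> ~~ e x z.
  move=> zD; apply/negP => exz.
  suff /domination_number_min : dominating e (D :\ x).
    by rewrite -cardD [#|D|](cardsD1 x) xD ltnn.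
  apply/forall_inP => u; rewrite !inE negb_and negbK.
  have [-> _|ux /= uD] := eqVneq u x; apply/exists_inP; last first.
    by have [y yD euy] := other u uD; exists y; rewrite // inE.
  have zx : z != x by apply: contraTneq exz => ->; rewrite e_irr.
  by exists z; rewrite !inE ?zx.
have [z] := set0Pn _ (e_noiso x); rewrite inE => exz.
have zD : z \notin D by apply: contraL exz; apply: isoxD.
pose D' := z |: D :\ x.
have D'P : minimum_dominating D'.
  apply/andP; split; last first.
    by rewrite cardsU1 !inE (negPf zD) andbF -cardD [#|D|](cardsD1 x) xD.
  apply/forall_inP => u; rewrite !inE !negb_or negb_and negbK => /andP[uz].
  have [-> _|ux /= uD] := eqVneq u x; apply/exists_inP.
    by exists z; rewrite !inE ?eqxx.
  by have [y yD euy] := other u uD; exists y; rewrite inE // yD orbT.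
(* [z] has a neighbour in [D :\ x], and removing [x] isolates no other vertex, since [x] has no
   neighbour in [D]. *)
have /subset_leq_card : isol D' \subset isol D :\ x.
  apply/subsetP => y; rewrite inE => /andP[/setU1P[->|yD] /forall_inP isoy].
    have [y' yD' ezy'] := other z zD.
    by have := isoy y' (setU1r _ yD'); rewrite ezy'.
  have /setD1P[yx yD1] := yD; rewrite !inE yx yD1 /=.
  apply/forall_inP => w wD; have [->|wx] := eqVneq w x.
    by rewrite e_sym isoxD.
  by apply: isoy; rewrite !inE wx wD orbT.
have xiso : x \in isol D by rewrite inE xD; apply/forall_inP.
move: (minD D' D'P); rewrite [X in X <= _](cardsD1 x) xiso => lt1 le1.
by have := leq_trans lt1 le1; rewrite ltnn.
Qed.

Theorem theorem16 (T : finType) (e : rel T)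
  (e_sym : symmetric e) (e_irr : irreflexive e)
  (e_noiso : no_isolated_vertex e)
  (e_bip : bipartite e)
  (eq_gamma_beta : domination_number e = vertex_cover_number e) :
  super_domination_number e = independence_number e.
Proof.
apply/eqP; rewrite eqn_leq; apply/andP; split; last first.
  rewrite /super_domination_number; case: arg_minnP.
    exact: super_dominatingT.
  move=> D supD _; apply/bigmax_leqP => A indA.
  exact: independent_leq_super_dominating indA supD.
have [D [cardD privD]] := exists_minimum_dominating_private _ _ e_sym e_irr e_noiso.
have supDC : super_dominating e (~: D).
  apply/forall_inP => u; rewrite setCK => /privD[v vD Nv].
  by apply/exists_inP; exists v; rewrite ?inE ?setCK ?Nv.
apply: leq_trans (super_domination_number_min _ _ _ supDC) _.
(* Adding [#|D|], here equal to the vertex cover number, to both sides leaves n <= beta + alpha. *)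
rewrite -(leq_add2l #|D|) cardsC cardD eq_gamma_beta.
exact: leq_card_vertex_cover_independence.
Qed.
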